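(* As formal power series, \[ \sum_{n=0}^\infty Q(\Gamma_n,x)\, y^n = \frac{1+y(x+y)}{1-y^2(x+y)}. \]
   Context: For $n\ge 1$, the Fibonacci cube $\Gamma_n$ has as vertices the binary strings of length $n$ with no two consecutive $1$s, adjacent iff they differ in exactly one position; $\Gamma_0$ is a single vertex. $Q_k$ is the $k$-dimensional hypercube ($Q_0$ a single vertex). A cube factor of a graph $G$ is a spanning subgraph whose components are all hypercubes $Q_k$, $k\ge 0$; it is optimal if no cube factor of $G$ has fewer components. For an optimal cube factor $\mathbf F$ of $G$, $q_k(G)$ is the number of components of $\mathbf F$ isomorphic to $Q_k$, and $Q(G,x)=\sum_{k\ge0} q_k(G)x^k$ (treated as determined by $G$). *)

(* Defs.v *)
From HB Require Import structures.
From mathcomp Require Import all_boot all_order all_algebra.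
From Stdlib Require Classical_Prop.

Set Implicit Arguments.
Unset Strict Implicit.
Unset Printing Implicit Defensive.

Import GRing.Theory.

(* A simple graph is a symmetric irreflexive relation on a finite type. *)

Section Graphs.

Definition isomorphic (S T : finType) (e : rel S) (e' : rel T) : bool :=
  [exists f : {ffun S -> T}, exists g : {ffun T -> S},
    [&& [forall x, g (f x) == x], [forall y, f (g y) == y] &
        [forall x, forall y, e' (f x) (f y) == e x y]]].

Definition hypercube_adj (n : nat) : rel (n.-tuple bool) :=
  fun u v => #|[set i | tnth u i != tnth v i]| == 1.

Lemma hypercube_adj_sym n : symmetric (@hypercube_adj n).
Proof.
move=> u v; rewrite /hypercube_adj; congr (_ == _).
by apply: eq_card => i; rewrite !inE eq_sym.
Qed.

Lemma hypercube_adj_irr n : irreflexive (@hypercube_adj n).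
Proof.
move=> u; rewrite /hypercube_adj.
suff -> : [set i | tnth u i != tnth u i] = set0 by rewrite cards0.
by apply/setP=> i; rewrite !inE eqxx.
Qed.

Variable T : finType.

Definition induced (f : rel T) (C : {set T}) : rel {x : T | x \in C} :=
  fun u v => f (val u) (val v).

(* The vertex sets of the connected components; meaningful for symmetric f. *)
Definition components (f : rel T) : {set {set T}} :=
  equivalence_partition (connect f) [set: T].

Definition is_Qcomp (f : rel T) (k : nat) (C : {set T}) : bool :=
  isomorphic (@induced f C) (@hypercube_adj k).

(* f is the adjacency relation of a spanning subgraph of the graph e. *)
Definition cube_factor (e f : rel T) : Prop :=
  [/\ symmetric f, subrel f e &
      forall C, C \in components f -> exists k, is_Qcomp f k C].

Definition optimal_cube_factor (e f : rel T) : Prop :=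
  cube_factor e f /\
  forall f', cube_factor e f' -> #|components f| <= #|components f'|.

Definition num_Qcomp (f : rel T) (k : nat) : nat :=
  #|[set C in components f | is_Qcomp f k C]|.

(* A component Q_k has 2 ^ k > k vertices, so truncating at #|T| loses nothing:
   see coef_cube_poly. *)
Definition cube_poly (f : rel T) : {poly int} :=
  \poly_(k < #|T|) (num_Qcomp f k)%:R%R.

Lemma coef_cube_poly f k : ((cube_poly f)`_k = (num_Qcomp f k)%:R)%R.
Proof.
rewrite coef_poly; case: ltnP => // le_Tk.
suff -> : num_Qcomp f k = 0 by [].
apply/eqP; rewrite /num_Qcomp cards_eq0; apply/eqP/setP=> C; rewrite !inE.
apply/negP=> /andP[_ /existsP[g /existsP[h /and3P[_ /forallP hK _]]]].
have h_inj : injective h by apply: (can_inj (g := g)) => y; apply/eqP.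
have := leq_card _ h_inj; rewrite card_tuple card_bool card_sig => le_kC.
have := leq_trans (ltn_expl k (ltnSn 1)) (leq_trans le_kC (max_card _)).
by rewrite ltnNge le_Tk.
Qed.

Lemma optimal_cube_factor_exists (e : rel T) :
  exists f, optimal_cube_factor e f.
Proof.
have [f] : exists f, cube_factor e f.
  exists (fun _ _ => false); split=> // C /imsetP[x _ ->]; exists 0.
  have con y : connect (fun _ _ : T => false) x y = (x == y).
    by apply/connectP/eqP => [[[|z p] //= _ ->]|->] //; exists [::].
  set D := [set _ in _ | _]; have Dx : x \in D by rewrite !inE connect0.
  have D1 (u : {y | y \in D}) : u = exist _ x Dx.
    by apply: val_inj; case: u => y /=; rewrite !inE con => /eqP.
  apply/existsP; exists [ffun=> [tuple]].
  apply/existsP; exists [ffun=> exist _ x Dx].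
  apply/and3P; split; apply/forallP => u; rewrite ?ffunE.
  - by rewrite [u]D1.
  - by rewrite [u]tuple0.
  - by apply/forallP=> v; rewrite !ffunE hypercube_adj_irr.
have [m] := ubnP #|components f|.
elim: m f => // m IH f lt_fm fP.
case: (Classical_Prop.classic (exists2 f', cube_factor e f' &
    #|components f'| < #|components f|)) => [[f' f'P lt_f']|nof].
  by apply: IH f'P; apply: leq_trans lt_f' _.
exists f; split=> // f' f'P; rewrite leqNgt; apply/negP=> lt_f'.
by apply: nof; exists f'.
Qed.

End Graphs.

Record fib_string (n : nat) := FibString {
  fib_val :> n.-tuple bool;
  _ : sorted (fun a b => ~~ (a && b)) fib_val
}.

HB.instance Definition _ n := [isSub for @fib_val n].
HB.instance Definition _ n := [Finite of fib_string n by <:].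

Definition fib_cube_adj (n : nat) : rel (fib_string n) :=
  fun u v => hypercube_adj u v.

Lemma fib_cube_adj_sym n : symmetric (@fib_cube_adj n).
Proof. by move=> u v; apply: hypercube_adj_sym. Qed.

Lemma fib_cube_adj_irr n : irreflexive (@fib_cube_adj n).
Proof. by move=> u; apply: hypercube_adj_irr. Qed.

(* Formal power series in one variable Y over a ring R, as coefficient
   sequences; equality of series is pointwise (=1). *)

Definition fps (R : Type) : Type := nat -> R.

Declare Scope fps_scope.
Delimit Scope fps_scope with fps.
Bind Scope fps_scope with fps.

Section PowerSeries.

Variable R : comUnitRingType.
Implicit Types a b : fps R.
Local Open Scope ring_scope.

Definition fpsC (c : R) : fps R := fun n => if n == 0%N then c else 0.
Definition fpsY : fps R := fun n => (n == 1%N)%:R.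
Definition fps_add a b : fps R := fun n => a n + b n.
Definition fps_sub a b : fps R := fun n => a n - b n.
Definition fps_mul a b : fps R := fun n => \sum_(i < n.+1) a i * b (n - i)%N.

(* The first n coefficients of a^-1, from the recursion
   b_0 = a_0^-1,  b_n = - a_0^-1 * \sum_(i < n) a_(n - i) * b_i. *)
Fixpoint fps_inv_seq a (n : nat) : seq R :=
  if n is m.+1 then
    let s := fps_inv_seq a m in
    rcons s (if m == 0%N then (a 0%N)^-1
             else - (a 0%N)^-1 * \sum_(i < m) a (m - i)%N * s`_i)
  else [::].

(* The inverse of a; meaningful when a 0 is a unit, see fps_mulV. *)
Definition fps_inv a : fps R := fun n => (fps_inv_seq a n.+1)`_n.
Definition fps_div a b : fps R := fps_mul a (fps_inv b).

Lemma size_fps_inv_seq a n : size (fps_inv_seq a n) = n.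
Proof. by elim: n => //= n IH; rewrite size_rcons IH. Qed.

Lemma nth_fps_inv_seq a m n : (n < m)%N -> (fps_inv_seq a m)`_n = fps_inv a n.
Proof.
elim: m => // m IH; rewrite ltnS leq_eqVlt => /predU1P[-> //|lt_nm].
by rewrite /= nth_rcons size_fps_inv_seq lt_nm IH.
Qed.

Lemma fps_mulV a : a 0%N \is a GRing.unit -> fps_mul a (fps_inv a) =1 fpsC 1.
Proof.
move=> Ua [|n]; rewrite /fps_mul /fpsC.
  by rewrite big_ord_recl big_ord0 addr0 /fps_inv /= divrr.
rewrite big_ord_recl subn0 {1}/fps_inv [fps_inv_seq _ _]/=.
rewrite -[rcons _ _]/(rcons (fps_inv_seq a n.+1) _).
rewrite nth_rcons size_fps_inv_seq ltnn eqxx mulNr mulrN mulVKr //.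
rewrite (reindex_inj rev_ord_inj) /= addrC; apply/eqP; rewrite subr_eq0.
apply/eqP/eq_bigr => i _; rewrite /bump /= add1n.
rewrite (subKn (ltn_ord i)) -/(fps_inv_seq a n.+1) nth_fps_inv_seq //.
by rewrite subSS ltnS leq_subr.
Qed.

End PowerSeries.

Arguments fpsY {R}.

Notation "c %:S" := (fpsC c%R)
  (at level 1, left associativity, format "c %:S") : fps_scope.
Notation "''Y'" := fpsY : fps_scope.
Notation "a + b" := (fps_add a b) : fps_scope.
Notation "a - b" := (fps_sub a b) : fps_scope.
Notation "a * b" := (fps_mul a b) : fps_scope.
Notation "a / b" := (fps_div a b) : fps_scope.

(* Main.v *)
Require Import Defs.
From mathcomp Require Import all_boot all_order all_algebra.
From mathcomp Require Import ring.

(** A copy of a hypercube inside a hypercube is a subcube, so a cube factor of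
    the Fibonacci cube is a partition of its vertices into intervals
    [a <= s <= m] of the componentwise order. A maximal Fibonacci string can
    only be the top of its interval, hence there are at least as many intervals
    as maximal strings, and this bound is attained; in an optimal factor the
    tops are exactly the maximal strings.

    Cut such a partition of length [n + 3] along the prefixes 10, 010 and 00.
    Every tile meets exactly one of the first two slices, and it gains one
    dimension precisely when it also meets the third one, so that
      Q(P) = Q(P_10) + Q(P_010) + (x - 1) Q(P_00).
    All three slices turn out to be optimal again, of lengths [n + 1], [n] and
    [n + 1], which gives Q_(n+3) = x Q_(n+1) + Q_n. *)

Set Implicit Arguments.
Unset Strict Implicit.
Unset Printing Implicit Defensive.

Import GRing.Theory.

(** * Fibonacci strings, the componentwise order and its intervals *)

Definition fib (s : seq bool) : bool := sorted (fun a b => ~~ (a && b)) s.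

Arguments fib : simpl never.

Definition sle (s t : seq bool) : bool := all2 implb s t.

(** The two components are the bottom and the top of an interval. *)
Definition tile : Type := (seq bool * seq bool)%type.

Definition mem_tile (c : tile) (s : seq bool) : bool := sle c.1 s && sle s c.2.

Definition tile_dim (c : tile) : nat :=
  count (fun p => p.1 != p.2) (zip c.1 c.2).

(** Asking the top to be a Fibonacci string suffices: by [fib_sle] the whole interval then consists
    of Fibonacci strings. *)
Definition tiling (n : nat) (l : seq tile) : Prop :=
  (forall c, c \in l -> [/\ sle c.1 c.2, fib c.2 & size c.2 = n]) /\
  (forall s, size s = n -> fib s -> count (mem_tile^~ s) l = 1).

Definition tiling_poly (l : seq tile) : {poly int} :=
  (\sum_(c <- l) 'X^(tile_dim c))%R.

Lemma fib_false s : fib (false :: s) = fib s.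
Proof. by case: s. Qed.

Lemma fib_true_false s : fib [:: true, false & s] = fib s.
Proof. by case: s. Qed.

Lemma fib_behead b s : fib (b :: s) -> fib s.
Proof. exact: path_sorted. Qed.

Lemma sle_refl s : sle s s.
Proof. by elim: s => //= x s ->; case: x. Qed.

Lemma sle_size s t : sle s t -> size s = size t.
Proof. by elim: s t => [|x s IH] [|y t] //= /andP[_ /IH ->]. Qed.

Lemma fib_sle s t : sle s t -> fib t -> fib s.
Proof.
elim: s t => [|x s IH] [|y t] //= /andP[xy st] ft.
case: s t st IH ft => [|x' s] [|y' t] // st IH /andP[yy' ft].
apply/andP; split; last exact: IH (y' :: t) st ft.
by case/andP: st {IH ft}; move: xy yy'; case: x x' y y' => [] [] [] [].
Qed.

Lemma mem_tile_top c : sle c.1 c.2 -> mem_tile c c.2.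
Proof. by rewrite /mem_tile => ->; rewrite sle_refl. Qed.

(** * Maximal Fibonacci strings *)

(** A maximal string of length at least 3 cannot begin with 00, whose first letter could be raised,
    nor with 011; so it begins with 10 or 010. As these prefixes end in 0, the rest is an arbitrary
    maximal string. *)
Fixpoint max_fib (n : nat) : seq (seq bool) :=
  match n with
  | 0 => [:: [::]]
  | 1 => [:: [:: true]]
  | 2 => [:: [:: true; false]; [:: false; true]]
  | (m.+1 as m1).+2 =>
      [seq [:: true, false & s] | s <- max_fib m1] ++
      [seq [:: false, true, false & s] | s <- max_fib m]
  end.

Arguments max_fib : simpl never.

Lemma max_fib_rec n : max_fib n.+3 =
  [seq [:: true, false & s] | s <- max_fib n.+1] ++
  [seq [:: false, true, false & s] | s <- max_fib n].
Proof. by []. Qed.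

Lemma nat_ind3 (P : nat -> Prop) : P 0 -> P 1 -> P 2 ->
  (forall n, P n -> P n.+1 -> P n.+3) -> forall n, P n.
Proof.
move=> P0 P1 P2 PS n.
suff: [/\ P n, P n.+1 & P n.+2] by case.
by elim: n => // n [Pn Pn1 Pn2]; split=> //; apply: PS.
Qed.

Lemma mem_max_fib10 n s :
  ([:: true, false & s] \in max_fib n.+2) = (s \in max_fib n).
Proof.
case: n => [|n]; first by rewrite /= !inE orbF; case: s.
rewrite max_fib_rec mem_cat mem_map; last by move=> x y [].
by rewrite [X in _ || X](_ : _ = false) ?orbF //; apply/mapP=> -[].
Qed.

Lemma mem_max_fib010 n s :
  ([:: false, true, false & s] \in max_fib n.+3) = (s \in max_fib n).
Proof.
rewrite max_fib_rec mem_cat orbC mem_map; last by move=> x y [].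
by rewrite [X in _ || X](_ : _ = false) ?orbF //; apply/mapP=> -[].
Qed.

Lemma max_fibP n s : s \in max_fib n.+3 ->
  (exists2 t, s = [:: true, false & t] & t \in max_fib n.+1) \/
  (exists2 t, s = [:: false, true, false & t] & t \in max_fib n).
Proof.
by rewrite max_fib_rec mem_cat => /orP[] /mapP[t tP ->]; [left | right]; exists t.
Qed.

Lemma max_fib_fib n s : s \in max_fib n -> fib s /\ size s = n.
Proof.
elim/nat_ind3: n s => [s|s|s|n IH IH1 s].
- by rewrite inE => /eqP->.
- by rewrite inE => /eqP->.
- by rewrite !inE => /orP[] /eqP->.
case/max_fibP=> -[t -> tP].
  by have [ft st] := IH1 _ tP; rewrite fib_true_false /= st.
by have [ft st] := IH _ tP; rewrite fib_false fib_true_false /= st.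
Qed.

Lemma max_fib_max n s t : s \in max_fib n -> fib t -> sle s t -> t = s.
Proof.
elim/nat_ind3: n s t => [s t|s t|s t|n IH IH1 s t].
- by rewrite inE => /eqP->; case: t.
- by rewrite inE => /eqP->; case: t => [|[] []].
- by rewrite !inE => /orP[] /eqP->; case: t => [|[] [|[] []]].
case/max_fibP=> -[u -> uP].
  case: t => [|[] [|[] t]] //=; rewrite fib_true_false => ft ut.
  by rewrite (IH1 _ _ uP ft ut).
case: t => [|[] [|[] [|[] t]]] //=; rewrite fib_false fib_true_false.
by move=> ft ut; rewrite (IH _ _ uP ft ut).
Qed.

Lemma max_fib_uniq n : uniq (max_fib n).
Proof.
elim/nat_ind3: n => // n IH IH1.
rewrite max_fib_rec cat_uniq !map_inj_uniq ?IH ?IH1 ?andbT /=;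
  try by move=> x y [].
by apply/hasPn=> s /mapP[t _ ->]; apply/mapP=> -[].
Qed.

(** A maximal string beginning with 1 is extended by 0, one beginning with 0 by 1. *)
Lemma max_fib_extend n s : s \in max_fib n ->
  false :: s \in max_fib n.+1 \/ true :: s \in max_fib n.+1.
Proof.
case: n => [|[|[|n]]].
- by rewrite inE => /eqP->; right.
- by rewrite inE => /eqP->; left.
- by rewrite !inE => /orP[] /eqP->; [left | right].
case/max_fibP=> -[t -> tP].
  by left; rewrite mem_max_fib010.
by right; rewrite !mem_max_fib10.
Qed.

(** * Tilings *)

Lemma tiling_inj n l s c c' : tiling n l -> size s = n -> fib s ->
  c \in l -> c' \in l -> mem_tile c s -> mem_tile c' s -> c = c'.
Proof.
move=> [_ lP] sn fs cl c'l cs c's; have := lP s sn fs.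
have : c \in filter (mem_tile^~ s) l by rewrite mem_filter cs.
have : c' \in filter (mem_tile^~ s) l by rewrite mem_filter c's.
rewrite -size_filter; case: (filter _ _) => [|x []] //.
by rewrite !inE => /eqP-> /eqP->.
Qed.

Lemma tiling_cover n l s : tiling n l -> size s = n -> fib s ->
  exists2 c, c \in l & mem_tile c s.
Proof.
by move=> [_ lP] sn fs; apply/hasP; rewrite has_count lP.
Qed.

(** The top of the tile covering a maximal string lies above that string, hence equals it. *)
Lemma max_fib_tops n l : tiling n l ->
  {subset max_fib n <= [seq c.2 | c <- l]}.
Proof.
move=> lT s sP; have [fs sn] := max_fib_fib sP.
have [c cl /andP[_ sc]] := tiling_cover lT sn fs.
have [_ fc _] := lT.1 c cl.
by rewrite -(max_fib_max sP fc sc) map_f.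
Qed.

(** Pigeonhole: the maximal strings are distinct and occur among the tops, so when there are no more
    tiles than maximal strings, no other top is left. *)
Lemma tops_max_fib n l : tiling n l -> size l <= size (max_fib n) ->
  forall c, c \in l -> c.2 \in max_fib n.
Proof.
move=> lT le c cl.
have [_ ->] := uniq_min_size (max_fib_uniq n) (max_fib_tops lT)
  (leq_trans (eq_leq (size_map _ _)) le).
exact: map_f.
Qed.

(** * Slices of a tiling along its first letter *)

Definition tile_slice (b : bool) (c : tile) : option tile :=
  match c with
  | (x :: a, y :: m) => if (x ==> b) && (b ==> y) then Some (a, m) else None
  | _ => None
  end.

Definition slice (b : bool) (l : seq tile) : seq tile := pmap (tile_slice b) l.

Lemma mem_tile_slice b c s :
  mem_tile c (b :: s) = oapp (mem_tile^~ s) false (tile_slice b c).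
Proof.
case: c => [[|x a] [|y m]] //=; rewrite /mem_tile /= ?andbF //.
by case: ifP => [/andP[-> ->]|] //=; case: (x ==> b) => //= ->; rewrite andbF.
Qed.

Lemma count_slice b l s :
  count (mem_tile^~ s) (slice b l) = count (mem_tile^~ (b :: s)) l.
Proof.
elim: l => //= c l IH; rewrite mem_tile_slice.
by case: (tile_slice b c) => /= [c'|]; rewrite /= IH.
Qed.

Lemma mem_slice b l c : c \in slice b l ->
  exists x y, [/\ (x :: c.1, y :: c.2) \in l, x ==> b & b ==> y].
Proof.
rewrite mem_pmap => /mapP[[[|x a] [|y m]] cl] //=.
by case: ifP => // /andP[xb by_] [->] /=; exists x, y.
Qed.

Lemma tiling_slice0 n l : tiling n.+1 l -> tiling n (slice false l).
Proof.
move=> [lV lC]; split=> [c|s sn fs].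
  case/mem_slice=> x [y [/lV[/= /andP[_ le] fc [sc]] _ _]].
  by split=> //; apply: fib_behead fc.
by rewrite count_slice lC ?fib_false //= sn.
Qed.

(** After a leading 1 only the letter 0 is possible, and behind 10 every Fibonacci string is
    allowed. *)
Lemma tiling_slice10 n l :
  tiling n.+2 l -> tiling n (slice false (slice true l)).
Proof.
move=> [lV lC]; split=> [c|s sn fs].
  case/mem_slice=> x [y [/mem_slice[x' [y' [/lV]]]]].
  case=> /= /and3P[_ _ ->] fc [->] _ _ _ _.
  by split=> //; apply: fib_behead (fib_behead fc).
by rewrite !count_slice lC ?fib_true_false //= sn.
Qed.

Lemma slice10_tops n l : (forall c, c \in l -> c.2 \in max_fib n.+2) ->
  tiling n.+2 l ->
  forall c, c \in slice false (slice true l) -> c.2 \in max_fib n.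
Proof.
move=> lM lT c /mem_slice[x [y [/mem_slice[x' [y' [cl _]]]]]].
have [_ /= fc _] := lT.1 _ cl; have /= := lM _ cl.
by case: y' y fc cl => [] [] //= fc cl; rewrite mem_max_fib10.
Qed.

Lemma slice010_tops n l : (forall c, c \in l -> c.2 \in max_fib n.+3) ->
  tiling n.+3 l ->
  forall c, c \in slice false (slice true (slice false l)) ->
  c.2 \in max_fib n.
Proof.
move=> lM lT c /mem_slice[x [y [/mem_slice[x' [y' [cl _]]]]]].
case/mem_slice: cl => x'' [y'' /= [cl x0 _]] y1 _ _.
have [_ /= fc _] := lT.1 _ cl; have /= := lM _ cl.
by case: y'' y' y y1 fc cl => [] [] [] //= _ fc cl; rewrite mem_max_fib010.
Qed.

(* The tiles with top [010s] that meet the prefix [00] cannot leave [0s]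
   non-maximal: otherwise [101s] is maximal, its tile is the only one that can
   cover both [001s] and [100s], hence it also covers [000s], which already
   belongs to the tile with top [010s]. *)
Lemma slice00_tops n l : (forall c, c \in l -> c.2 \in max_fib n.+3) ->
  tiling n.+3 l ->
  forall c, c \in slice false (slice false l) -> c.2 \in max_fib n.+1.
Proof.
move=> lM lT c /mem_slice[x [y [/mem_slice[x' [y' [cl]]]]]].
have /= := lM _ cl; case/max_fibP => -[t [Ey' Ey eqt] tM]; first by rewrite eqt.
rewrite {}Ey {}Ey' {y y'} in cl *; case: x x' cl => [] [] // cl _ _ _ _.
rewrite eqt in cl *.
case: (max_fib_extend tM) => // t1M.
have [ft st] := max_fib_fib tM; have [f1t _] := max_fib_fib t1M.
have [c2 c2l c2P] : exists2 c, c \in l & mem_tile c [:: false, false, true & t].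
  by apply: (tiling_cover lT); rewrite ?fib_false //= st.
have [c4 c4l c4P] : exists2 c, c \in l & mem_tile c [:: true, false, false & t].
  by apply: (tiling_cover lT); rewrite ?fib_true_false ?fib_false //= st.
have c2t : c2.2 = [:: true, false, true & t].
  have [_ fc _] := lT.1 _ c2l.
  case/andP: c2P => _; case/max_fibP: (lM _ c2l) fc => -[u -> uM] //= fu le.
  by rewrite -(max_fib_max t1M _ le) //; apply: (max_fib_fib uM).1.
(* The top of [c4] is [10u] with the tail of [u] above the maximal [t], hence equal to it; the first
   letter of [u] is then 1, because [0t] lies below the Fibonacci string [1t]. *)
have c4t : c4.2 = [:: true, false, true & t].
  have [_ fc _] := lT.1 _ c4l.
  case/andP: c4P => _; case/max_fibP: (lM _ c4l) fc => -[u -> uM] //= fu.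
  case: u uM fu => [|b u] //= uM fu le.
  have [fbu _] := max_fib_fib uM.
  have ut : u = t by apply: max_fib_max tM _ le; apply: fib_behead fbu.
  rewrite ut in uM *; case: b uM {fu fbu} => // uM.
  by have := max_fib_max uM f1t; rewrite /= sle_refl => /(_ isT).
have eqc : c2 = c4.
  have [c24 f2 s2] := lT.1 _ c2l; have [c44 _ _] := lT.1 _ c4l.
  apply: (tiling_inj lT s2 f2 c2l c4l); first exact: mem_tile_top.
  by rewrite c2t -c4t mem_tile_top.
(* The common bottom lies below both [001t] and [100t], hence below [000t]. *)
have c20 : mem_tile c2 [:: false, false, false & t].
  rewrite -eqc in c4P; case/andP: c2P c4P => c2P _ /andP[c4P _].
  rewrite /mem_tile c2t /= sle_refl !andbT.
  by case: (c2.1) c2P c4P => [|[] [|[] [|[] a]]].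
have [/= le _ _] := lT.1 _ cl.
have /(congr1 snd) : ([:: false, false & c.1], [:: false, true, false & t]) = c2.
  apply: (tiling_inj lT _ _ cl c2l _ c20); rewrite ?fib_false //= ?st //.
  by rewrite /mem_tile /= sle_refl andbT.
by rewrite /= c2t.
Qed.

(** * The polynomial of a tiling with maximal tops *)

Lemma big_slice (F : tile -> {poly int}) b l : (\sum_(c <- slice b l) F c =
  \sum_(c <- l) oapp F 0 (tile_slice b c))%R.
Proof.
elim: l => [|c l IH]; first by rewrite !big_nil.
rewrite big_cons -IH /=; case: (tile_slice b c) => [c'|] /=.
  by rewrite big_cons.
by rewrite add0r.
Qed.

Fixpoint cube_poly_rec (n : nat) : {poly int} :=
  (match n with
  | 0 => 1
  | 1 => 'X
  | 2 => 'X + 1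
  | (m.+1 as m1).+2 => 'X * cube_poly_rec m1 + cube_poly_rec m
  end)%R.

Arguments cube_poly_rec : simpl never.

Lemma cube_poly_recE n :
  (cube_poly_rec n.+3 = 'X * cube_poly_rec n.+1 + cube_poly_rec n)%R.
Proof. by []. Qed.

Lemma tiling0_poly l : tiling 0 l -> tiling_poly l = 1%R.
Proof.
case=> lV /(_ [::] erefl isT); rewrite /tiling_poly.
have {lV} : all (pred1 ([::], [::])) l.
  apply/allP=> -[a m] /lV[/= /sle_size am _ /size0nil m0].
  by rewrite m0 in am *; rewrite /= (size0nil am).
case: l => [|c [|c' l]] //= /andP[/eqP-> //].
  by move=> _ _; rewrite big_seq1.
by case/andP=> /eqP->.
Qed.

(** In length 1 no letter follows the leading 1, so this slice needs no further cut at 0. *)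
Lemma tiling_slice1 l : tiling 1 l -> tiling 0 (slice true l).
Proof.
case=> lV lC; split=> [c|s sn fs].
  case/mem_slice=> x [y [/lV[/= /andP[_ le] fc [sc]] _ _]].
  by split=> //; apply: fib_behead fc.
by rewrite count_slice lC //= (size0nil sn).
Qed.

Lemma tiling1_poly l : tiling 1 l ->
  (forall c, c \in l -> c.2 \in max_fib 1) -> tiling_poly l = 'X%R.
Proof.
move=> lT lM; have l0 := tiling0_poly (tiling_slice0 lT).
have l1 := tiling0_poly (tiling_slice1 lT).
have -> : (tiling_poly l = ('X - 1) * tiling_poly (slice false l) +
    tiling_poly (slice true l))%R; last by rewrite l0 l1 mulr1 subrK.
rewrite /tiling_poly !big_slice mulr_sumr -big_split; apply: eq_big_seq => c cl.
have [] := lT.1 c cl; have := lM c cl; case: c {cl} => a m /=.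
rewrite inE => /eqP->; case: a => [|[] [|//]] //= _ _ _.
  by rewrite mulr0 add0r.
by rewrite mulr1 subrK.
Qed.

Lemma tiling2_poly l : tiling 2 l ->
  (forall c, c \in l -> c.2 \in max_fib 2) -> tiling_poly l = ('X + 1)%R.
Proof.
move=> lT lM; have lT0 := tiling_slice0 lT.
have l10 := tiling0_poly (tiling_slice10 lT).
have l00 := tiling0_poly (tiling_slice0 lT0).
have l01 := tiling0_poly (tiling_slice1 lT0).
have -> : (tiling_poly l =
    ('X - 1) * tiling_poly (slice false (slice false l)) +
    tiling_poly (slice false (slice true l)) +
    tiling_poly (slice true (slice false l)))%R.
  2: by rewrite l00 l10 l01 mulr1 subrK.
rewrite /tiling_poly !big_slice mulr_sumr -!big_split; apply: eq_big_seq => c cl.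
have [] := lT.1 c cl; have := lM c cl; case: c {cl} => a m /=.
rewrite !inE => /orP[] /eqP->; case: a => [|[] [|[] [|//]]] //= _ _ _;
  by rewrite ?mulr0 ?add0r ?addr0 ?mulr1 ?subrK.
Qed.

(** The identity holds tile by tile. Let [d] be the dimension of the tile behind its prefix. If its
    bottom starts with 10 or 010, it meets a single slice and both sides give ['X^d]. If its bottom
    starts with 00, it also meets the 00 slice, and [('X - 1) * 'X^d + 'X^d] is ['X^(d.+1)]. *)
Lemma tiling_poly_rec n l : tiling n.+3 l ->
  (forall c, c \in l -> c.2 \in max_fib n.+3) ->
  tiling_poly l =
    (('X - 1) * tiling_poly (slice false (slice false l)) +
     tiling_poly (slice false (slice true l)) +
     tiling_poly (slice false (slice true (slice false l))))%R.
Proof.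
move=> lT lM; rewrite /tiling_poly !big_slice mulr_sumr -!big_split.
apply: eq_big_seq => c cl.
have [] := lT.1 c cl; have := lM c cl; case: c {cl} => a m /=.
case/max_fibP=> -[t -> _]; case: a => [|[] [|[] a]] //=.
- by move=> _ _ _; rewrite /tile_dim /= mulr0 add0r addr0.
- by move=> _ _ _; rewrite /tile_dim /= addr0 exprS mulrBl mul1r subrK.
- by case: a => [|[] a] //= _ _ _; rewrite /tile_dim /= mulr0 !add0r.
- case: a => [|[] a] //= _ _ _; rewrite /tile_dim /= addr0.
  by rewrite exprS mulrBl mul1r subrK.
Qed.

Lemma tiling_poly_max n l : tiling n l ->
  (forall c, c \in l -> c.2 \in max_fib n) -> tiling_poly l = cube_poly_rec n.
Proof.
elim/nat_ind3: n l => [l lT _|l|l|n IH IH1 l lT lM].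
- exact: tiling0_poly.
- exact: tiling1_poly.
- exact: tiling2_poly.
rewrite (tiling_poly_rec lT lM).
rewrite (IH1 _ (tiling_slice0 (tiling_slice0 lT)) (slice00_tops lM lT)).
rewrite (IH1 _ (tiling_slice10 lT) (slice10_tops lM lT)).
rewrite (IH _ (tiling_slice10 (tiling_slice0 lT)) (slice010_tops lM lT)).
by rewrite mulrBl mul1r subrK.
Qed.

(** * A tiling attaining the bound *)

Fixpoint std_tiling (n : nat) : seq tile :=
  match n with
  | 0 => [:: ([::], [::])]
  | 1 => [:: ([:: false], [:: true])]
  | 2 => [:: ([:: false; false], [:: true; false]);
             ([:: false; true], [:: false; true])]
  | (m.+1 as m1).+2 =>
      [seq ([:: false, false & c.1], [:: true, false & c.2])
         | c <- std_tiling m1] ++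
      [seq ([:: false, true, false & c.1], [:: false, true, false & c.2])
         | c <- std_tiling m]
  end.

Lemma std_tiling_rec n : std_tiling n.+3 =
  [seq ([:: false, false & c.1], [:: true, false & c.2])
     | c <- std_tiling n.+1] ++
  [seq ([:: false, true, false & c.1], [:: false, true, false & c.2])
     | c <- std_tiling n].
Proof. by []. Qed.

Arguments std_tiling : simpl never.

Lemma size_std_tiling n : size (std_tiling n) = size (max_fib n).
Proof.
elim/nat_ind3: n => // n IH IH1.
by rewrite std_tiling_rec max_fib_rec !size_cat !size_map IH IH1.
Qed.

(** Strings with prefix 00 or 10 are covered by a tiling of length [n.+1] doubled in the first
    coordinate, those with prefix 010 by a copy of a tiling of length [n]. *)
Lemma std_tilingP n : tiling n (std_tiling n).
Proof.
elim/nat_ind3: n => [|||n [IHv IHc] [IHv1 IHc1]].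
- split=> [c|s]; first by rewrite inE => /eqP->.
  by move/size0nil->.
- split=> [c|[|[] [|//]] //]; by rewrite inE => /eqP->.
- split=> [c|[|[] [|[] [|//]]] //]; by rewrite !inE => /orP[] /eqP->.
rewrite std_tiling_rec; split=> [c|s sn fs].
  rewrite mem_cat => /orP[] /mapP[c' c'l ->] /=.
    by have [-> f ->] := IHv1 c' c'l; rewrite fib_true_false.
  by have [-> f ->] := IHv c' c'l; rewrite fib_false fib_true_false.
rewrite count_cat !count_map.
have count0 (l : seq tile) (P : pred tile) : (forall c, P c = false) -> count P l = 0.
  by move=> P0; rewrite (eq_count P0) count_pred0.
case: s sn fs => [|b0 [|b1 [|b2 s]]] // [sn] fs.
have f1 := fib_behead fs; have f2 := fib_behead f1.
(* The second letter selects the family: a 1 forces the prefix 010, while after a 0 the first letter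
   is free. *)
case: b1 fs f1 f2 => [fs f1 f2|fs f1 f2].
  have -> : b0 = false by case: b0 fs.
  have b2E : b2 = false by case: b2 f1 {fs f2}.
  rewrite count0 => [|c]; last by rewrite /= /mem_tile /= !andbF.
  by rewrite b2E in f2 *; rewrite add0n -[RHS](IHc s) // (fib_behead f2).
rewrite [X in _ + X]count0 => [|c]; last first.
  by rewrite /= /mem_tile /= ?andbF; case: b0 {fs}; rewrite ?andbF.
rewrite addn0 -[RHS](IHc1 (b2 :: s)) //= ?sn //.
by apply: eq_count => c; rewrite /= /mem_tile /= implybT.
Qed.

(** * Subcubes of hypercubes *)

Lemma isomorphicP (S T : finType) (e : rel S) (e' : rel T) :
  reflect (exists f : S -> T, exists g : T -> S,
    [/\ cancel f g, cancel g f & forall x y, e' (f x) (f y) = e x y])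
  (isomorphic e e').
Proof.
apply: (iffP existsP) => [[f /existsP[g /and3P[/forallP fK /forallP gK eP]]]|].
  exists f, g; split=> [x|y|x y]; apply/eqP => //.
  by have /forallP/(_ x)/forallP := eP.
case=> f [g [fK gK eP]]; exists (finfun f); apply/existsP; exists (finfun g).
apply/and3P; split; apply/forallP => x; rewrite ?ffunE ?fK ?gK //.
by apply/forallP=> y; rewrite !ffunE eP.
Qed.

Lemma tnth_zip n (T1 T2 : Type) (u : n.-tuple T1) (v : n.-tuple T2) i :
  tnth [tuple of zip u v] i = (tnth u i, tnth v i).
Proof.
have x1 := tnth u i; have x2 := tnth v i.
by rewrite (tnth_nth (x1, x2)) nth_zip ?size_tuple // -!tnth_nth.
Qed.

Lemma sleP n (u v : n.-tuple bool) :
  reflect (forall i, tnth u i -> tnth v i) (sle u v).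
Proof.
rewrite /sle all2E !size_tuple eqxx.
apply: (iffP (@all_tnthP _ _ _ [tuple of zip u v])) => uv i.
  by have := uv i; rewrite tnth_zip => /implyP.
by rewrite tnth_zip; apply/implyP/uv.
Qed.

Lemma tile_dim_tnth n (u v : n.-tuple bool) :
  tile_dim (tval u, tval v) = #|[set i | tnth u i != tnth v i]|.
Proof.
rewrite /tile_dim -sum1_count (big_tuple _ _ [tuple of zip u v]) -sum1_card.
by apply: eq_bigl => i; rewrite tnth_zip inE.
Qed.

Definition flip n (u : n.-tuple bool) (i : 'I_n) : n.-tuple bool :=
  [tuple (i == j) (+) tnth u j | j < n].

Lemma tnth_flip n (u : n.-tuple bool) i j :
  tnth (flip u i) j = (i == j) (+) tnth u j.
Proof. by rewrite tnth_mktuple. Qed.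

Lemma flipK n (u : n.-tuple bool) i : flip (flip u i) i = u.
Proof. by apply: eq_from_tnth => j; rewrite !tnth_flip addKb. Qed.

Lemma flipC n (u : n.-tuple bool) i j : flip (flip u i) j = flip (flip u j) i.
Proof. by apply: eq_from_tnth => k; rewrite !tnth_flip addbCA. Qed.

Lemma flip_inj n (u : n.-tuple bool) : injective (flip u).
Proof.
move=> i j /(congr1 (fun w => tnth w i)); rewrite !tnth_flip eqxx => /addIb.
by move/esym/eqP.
Qed.

Lemma flip_flip_neq n (u : n.-tuple bool) i j :
  (flip (flip u i) j == u) = (i == j).
Proof.
apply/eqP/eqP => [/(congr1 (fun w => flip w j))|->]; last exact: flipK.
by rewrite flipK; apply: flip_inj.
Qed.

Lemma hypercube_adjP n (u v : n.-tuple bool) :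
  reflect (exists i, v = flip u i) (hypercube_adj u v).
Proof.
apply: (iffP cards1P) => -[i uv]; exists i.
  apply: eq_from_tnth => j; rewrite tnth_flip.
  have /setP/(_ j) := uv; rewrite !inE (eq_sym i) => <-.
  by case: (tnth u j) (tnth v j) => [] [].
apply/setP=> j; rewrite !inE uv tnth_flip (eq_sym i).
by case: (j == i) (tnth u j) => [] [].
Qed.

(** Induction on the number of ones, flipping one of them to 0. *)
Lemma flip_ind n (P : n.-tuple bool -> Prop) :
  P [tuple false | _ < n] -> (forall u i, P u -> P (flip u i)) -> forall u, P u.
Proof.
move=> P0 PS u; have [m] := ubnP #|[set i | tnth u i]|.
elim: m u => // m IH u; rewrite ltnS => le_m.
have [u0|[i]] := set_0Vmem [set i | tnth u i].
  suff -> : u = [tuple false | _ < n] by [].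
  apply: eq_from_tnth => i; rewrite tnth_mktuple.
  by have /setP/(_ i) := u0; rewrite !inE.
rewrite inE => ui; rewrite -(flipK u i); apply: PS; apply: IH.
apply: leq_trans le_m; apply: proper_card; apply/properP; split.
  apply/subsetP=> j; rewrite !inE tnth_flip.
  by case: eqP => // <-; rewrite ui.
by exists i; rewrite !inE ?tnth_flip ?eqxx ui.
Qed.

(* In a 4-cycle of a hypercube opposite edges have the same direction, hence
   the direction of the image of an edge depends only on its own direction. *)
Lemma hypercube_embedding n k (psi : k.-tuple bool -> n.-tuple bool) :
  injective psi ->
  (forall u v, hypercube_adj u v -> hypercube_adj (psi u) (psi v)) ->
  exists2 D : {set 'I_n}, #|D| = k &
    exists w0, forall w,
      (exists u, psi u = w) <-> (forall i, i \notin D -> tnth w i = tnth w0 i).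
Proof.
move=> psi_inj psi_adj; set u0 := [tuple false | _ < k].
(* [dl (u, j)] is the direction of the image of the edge leaving [u] in direction [j]. *)
have [dl dlP] : exists dl : k.-tuple bool * 'I_k -> 'I_n,
    forall p, psi (flip p.1 p.2) = flip (psi p.1) (dl p).
  apply: (@fin_all_exists _ (fun=> 'I_n)
    (fun p i => psi (flip p.1 p.2) = flip (psi p.1) i)) => -[u j] /=.
  by apply/hypercube_adjP/psi_adj/hypercube_adjP; exists j.
have {}dlP u j : psi (flip u j) = flip (psi u) (dl (u, j)) by exact: dlP (u, j).
have dl_inj u : injective (fun j => dl (u, j)).
  move=> i j /= e; apply: (@flip_inj _ u); apply: psi_inj.
  by rewrite !dlP e.
have dl_square u i j : i != j -> dl (flip u i, j) = dl (u, j).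
  move=> ij; have e := congr1 psi (flipC u i j); rewrite !dlP in e.
  have n1 : dl (u, i) != dl (u, j) by rewrite (inj_eq (dl_inj u)).
  have n2 : dl (u, i) != dl (flip u i, j).
    by rewrite -(flip_flip_neq (psi u)) -!dlP (inj_eq psi_inj) flip_flip_neq.
  (* If the opposite edges had different directions, the coordinate [dl (flip u i, j)] would force
     [dl (flip u j, i)] to equal it; then the coordinate [dl (u, j)] would change along one side of
     the square only. *)
  apply/eqP; apply: contraT => n3.
  have e1 := congr1 (fun w => tnth w (dl (flip u i, j))) e.
  have e2 := congr1 (fun w => tnth w (dl (u, j))) e.
  rewrite !tnth_flip eqxx (negPf n2) (eq_sym (dl (u, j))) (negPf n3) in e1.
  rewrite !tnth_flip eqxx (negPf n1) (negPf n3) in e2.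
  have s_q : dl (flip u j, i) = dl (flip u i, j).
    by apply/eqP; move: e1; case: (_ == _) => //; case: (tnth _ _).
  by move: e2; rewrite s_q (negPf n3); case: (tnth _ _).
have dlE u j : dl (u, j) = dl (u0, j).
  (* For [i = j] both edges are the same one, traversed in opposite senses. *)
  elim/flip_ind: u => // u i <-; have [<-|] := eqVneq i j; last exact: dl_square.
  have := dlP (flip u i) i; rewrite flipK dlP => /eqP.
  by rewrite eq_sym flip_flip_neq => /eqP.
pose d j := dl (u0, j); have d_inj : injective d := dl_inj u0.
exists [set d j | j in 'I_k]; first by rewrite card_imset ?card_ord.
(* [psi] is affine: up to the constant [psi u0], coordinate [d j] of the image copies coordinate
   [j]. *)
have psi_in u j : tnth (psi u) (d j) = tnth (psi u0) (d j) (+) tnth u j.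
  elim/flip_ind: u => [|u i IH]; first by rewrite tnth_mktuple addbF.
  by rewrite dlP dlE !tnth_flip IH (inj_eq d_inj) addbCA.
exists (psi u0) => w; split=> [[u <- i iD]|wP].
  elim/flip_ind: u => // u j <-; rewrite dlP dlE tnth_flip.
  by case: eqP => // di; case/imsetP: iD; exists j.
exists [tuple tnth (psi u0) (d j) (+) tnth w (d j) | j < k].
apply: eq_from_tnth => i.
have [/imsetP[j _ ->]|iD] := boolP (i \in [set d j | j in 'I_k]).
  by rewrite psi_in tnth_mktuple addKb.
rewrite wP //; move: iD; set u := [tuple _ | j < k]; move: u => u iD.
elim/flip_ind: u => // u j <-; rewrite dlP dlE tnth_flip.
by case: eqP => // di; case/imsetP: iD; exists j.
Qed.

(** * Tilings and cube factors *)

Lemma fib_val_inj n : injective (@fib_val n).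
Proof. exact: val_inj. Qed.

Lemma fib_string_fib n (u : fib_string n) : fib u.
Proof. by case: u. Qed.

Definition tile_set n (c : tile) : {set fib_string n} :=
  [set u : fib_string n | mem_tile c u].

Definition tile_rel n (l : seq tile) : rel (fib_string n) :=
  fun u v => fib_cube_adj u v && has (fun c => mem_tile c u && mem_tile c v) l.

(** Correct one differing coordinate of [u] at a time. Each intermediate string takes its letters
    from [u] and [v], so it stays in the interval and, being below the top, is a Fibonacci
    string. *)
Lemma connect_tile n (l : seq tile) c (u v : fib_string n) :
  c \in l -> fib c.2 -> mem_tile c u -> mem_tile c v ->
  connect (tile_rel l) u v.
Proof.
move=> cl fc cu cv.
have [m] := ubnP #|[set i | tnth u i != tnth v i]|.
elim: m u cu => // m IH u cu; rewrite ltnS => le_m.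
have [uv|[i]] := set_0Vmem [set i | tnth u i != tnth v i].
  suff -> : u = v by [].
  apply: fib_val_inj; apply: eq_from_tnth => i.
  by have /setP/(_ i) := uv; rewrite !inE => /negbFE/eqP.
rewrite inE => uvi.
have wE j : tnth (flip u i) j = if i == j then tnth v j else tnth u j.
  rewrite tnth_flip; case: eqP => // <-.
  by case: (tnth u i) (tnth v i) uvi => [] [].
have cw : mem_tile c (flip u i).
  have sc1 : size c.1 == n by case/andP: cu => /sle_size->; rewrite size_tuple.
  have sc2 : size c.2 == n by case/andP: cu => _ /sle_size<-; rewrite size_tuple.
  move: sc1 sc2 cu cv; rewrite /mem_tile; move: (c.1) (c.2) => a b sa sb.
  case/andP=> /(@sleP _ (Tuple sa))au /(@sleP _ _ (Tuple sb))ub.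
  case/andP=> /(@sleP _ (Tuple sa))av /(@sleP _ _ (Tuple sb))vb.
  apply/andP; split.
    apply/(@sleP _ (Tuple sa)) => j aj; rewrite wE.
    by case: ifP => _; [apply: av | apply: au].
  apply/(@sleP _ _ (Tuple sb)) => j; rewrite wE.
  by case: ifP => _; [apply: vb | apply: ub].
have fw : fib (flip u i) by case/andP: cw => _ /fib_sle; apply.
apply: (@connect_trans _ _ (FibString fw : fib_string n)).
  apply/connect1/andP; split; first by apply/hypercube_adjP; exists i.
  by apply/hasP; exists c; rewrite ?cu.
apply: IH => //=; apply: leq_trans le_m; apply: proper_card; apply/properP; split.
  apply/subsetP=> j; rewrite !inE wE; case: ifP => // _; rewrite ?eqxx //.
by exists i; rewrite !inE ?wE ?eqxx.
Qed.

(** Members of the tile agree with [a] outside the set [D] where bottom and top differ, and are free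
    on [D]. So reading the coordinates in [D] is an isomorphism, with inverse [w] filling in [a]
    elsewhere. *)
Lemma is_Qcomp_tile n (l : seq tile) (a m : n.-tuple bool) :
  (tval a, tval m) \in l -> fib m -> sle a m ->
  is_Qcomp (tile_rel l) #|[set i | tnth a i != tnth m i]|
    (tile_set n (tval a, tval m)).
Proof.
set D := [set i | _]; set c := (tval a, tval m) => cl fm am.
apply/isomorphicP.
pose C := tile_set n c.
pose f (x : {x | x \in C}) : #|D|.-tuple bool :=
  [tuple tnth (val x) (enum_val j) | j < #|D|].
pose w (t : #|D|.-tuple bool) : n.-tuple bool :=
  [tuple if [pick j | enum_val j == i] is Some j then tnth t j else tnth a i
    | i < n].
have w_in t j : tnth (w t) (enum_val j) = tnth t j.
  rewrite tnth_mktuple; case: pickP => [j' /eqP/enum_val_inj-> //|/(_ j)].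
  by rewrite eqxx.
have w_out t i : i \notin D -> tnth (w t) i = tnth a i.
  move=> iD; rewrite tnth_mktuple; case: pickP => // j /eqP ji.
  by rewrite -ji enum_valP in iD.
have C_out (x : fib_string n) i : x \in C -> i \notin D -> tnth x i = tnth a i.
  rewrite !inE => /andP[/sleP/(_ i) ax /sleP/(_ i) xm] /negbNE/eqP am_i.
  by apply/idP/idP => // xi; rewrite am_i xm.
have wC t : mem_tile c (w t).
  have am_i i := sleP _ _ am i.
  apply/andP; split; apply/sleP => i.
    have [|iD] := boolP (i \in D); last by rewrite w_out.
    by rewrite inE => am' ai; rewrite ai am_i in am'.
  have [|iD] := boolP (i \in D); last by rewrite w_out //; apply: am_i.
  by rewrite inE; case: (tnth a i) (tnth m i) (am_i i) => [] [] // /(_ isT).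
have wf t : fib (w t) by case/andP: (wC t) => _ /fib_sle; apply.
have wC' t : (FibString (wf t) : fib_string n) \in C.
  by rewrite inE; apply: wC.
exists f, (fun t => exist (fun x => x \in C) (FibString (wf t)) (wC' t)).
split=> [x|t|x y].
- apply: val_inj; apply: fib_val_inj; apply: eq_from_tnth => i /=.
  have [iD|iD] := boolP (i \in D); last by rewrite w_out // (C_out _ _ (valP x)).
  rewrite -(enum_rankK_in iD iD) w_in tnth_mktuple.
  by rewrite enum_rankK_in.
- by apply: eq_from_tnth => j; rewrite tnth_mktuple w_in.
rewrite /induced /tile_rel.
have -> : has (fun c0 => mem_tile c0 (val x) && mem_tile c0 (val y)) l.
  by apply/hasP; exists c => //; have := valP x; have := valP y; rewrite !inE => -> ->.
rewrite andbT /fib_cube_adj /hypercube_adj; congr (_ == _).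
(* All coordinates where [x] and [y] differ lie in [D], so reading only these preserves their
   number. *)
rewrite -(card_imset _ (@enum_val_inj _ (mem D))); apply: eq_card => i.
rewrite inE; apply/imsetP/idP => [[j]|xy].
  by rewrite inE !tnth_mktuple => xy ->.
have [iD|iD] := boolP (i \in D).
  exists (enum_rank_in iD i); last by rewrite enum_rankK_in.
  by rewrite inE !tnth_mktuple enum_rankK_in.
by move: xy; rewrite !(C_out _ _ (valP _)) // eqxx.
Qed.

(** A tile is connected, and a path cannot leave it: each edge lies inside some tile, which by
    disjointness is the tile of its starting point. *)
Lemma components_of_tiling n (l : seq tile) (C : {set fib_string n}) :
  tiling n l -> C \in components (tile_rel l) ->
  exists2 c, c \in l & C = tile_set n c.
Proof.
move=> lT /imsetP[x _ ->].
have [c cl cx] := tiling_cover lT (size_tuple x) (fib_string_fib x).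
exists c => //; have [_ fc _] := lT.1 c cl.
apply/setP=> y; rewrite !inE; apply/idP/idP; last exact: connect_tile.
case/connectP=> p + ->; elim: p x cx => //= z p IH x cx /andP[xz].
apply: IH; case/andP: xz => _ /hasP[c' c'l /andP[c'x c'z]].
by rewrite (tiling_inj lT (size_tuple x) (fib_string_fib x) cl c'l cx c'x).
Qed.

Lemma tile_rel_factor n l : tiling n l ->
  cube_factor (@fib_cube_adj n) (@tile_rel n l).
Proof.
move=> lT; split=> [u v|u v /andP[] //|C].
  rewrite /tile_rel fib_cube_adj_sym; congr (_ && _).
  by apply: eq_has => c; rewrite andbC.
move=> CP; have [[a m] cl ->] := components_of_tiling lT CP.
have [/= am fm /eqP sm] := lT.1 _ cl; have sa := sm; rewrite -(sle_size am) in sa.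
exists #|[set i | tnth (Tuple sa) i != tnth (Tuple sm) i]|.
exact: (@is_Qcomp_tile n l (Tuple sa) (Tuple sm)).
Qed.

Lemma card_components_tile_rel n l : tiling n l ->
  #|components (@tile_rel n l)| <= size l.
Proof.
move=> lT; rewrite cardE -(size_map (tile_set n) l).
apply: uniq_leq_size (enum_uniq _) _ => C; rewrite mem_enum => CP.
by have [c cl ->] := components_of_tiling lT CP; apply: map_f.
Qed.

Lemma is_Qcomp_card (T : finType) (f : rel T) k C : is_Qcomp f k C -> #|C| = 2 ^ k.
Proof.
case/isomorphicP=> g [h [gK hK _]].
have := bij_eq_card (Bijective gK hK).
by rewrite card_sig card_tuple card_bool.
Qed.

Lemma is_Qcomp_inj (T : finType) (f : rel T) j k C :
  is_Qcomp f j C -> is_Qcomp f k C -> j = k.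
Proof.
move=> /is_Qcomp_card Ej /is_Qcomp_card; rewrite Ej => /eqP.
by rewrite eqn_exp2l // => /eqP.
Qed.

(** The inverse isomorphism embeds a hypercube into the ambient one, so its image is a subcube with
    free directions [D]. Putting 0 or 1 on all of [D] gives bottom and top; the top belongs to the
    image and is thus a Fibonacci string. *)
Lemma is_Qcomp_tile_set n (f : rel (fib_string n)) k C :
  subrel f (@fib_cube_adj n) -> is_Qcomp f k C ->
  exists c, [/\ sle c.1 c.2, fib c.2, size c.2 = n, tile_dim c = k &
    C = tile_set n c].
Proof.
move=> fe /isomorphicP[g [h [gK hK ghP]]].
pose psi (u : k.-tuple bool) : n.-tuple bool := fib_val (val (h u)).
have psi_inj : injective psi.
  by move=> u v /fib_val_inj/val_inj/(can_inj hK).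
have psi_adj u v : hypercube_adj u v -> hypercube_adj (psi u) (psi v).
  by move=> uv; apply: fe; rewrite -[f _ _]ghP !hK.
have [D Dk [w0 wP]] := hypercube_embedding psi_inj psi_adj.
pose ext b : n.-tuple bool := [tuple if i \in D then b else tnth w0 i | i < n].
have ext_in b i : i \in D -> tnth (ext b) i = b by rewrite tnth_mktuple => ->.
have ext_out b i : i \notin D -> tnth (ext b) i = tnth w0 i.
  by rewrite tnth_mktuple => /negPf->.
move: ext ext_in ext_out => ext ext_in ext_out.
have extP w : mem_tile (tval (ext false), tval (ext true)) (tval w) <->
    (forall i, i \notin D -> tnth w i = tnth w0 i).
  split=> [/andP[/sleP lo /sleP hi] i iD|wD].
    have := lo i; have := hi i; rewrite !ext_out //.
    by case: (tnth w i) (tnth w0 i) => [] [] //= => [/(_ isT)|_ /(_ isT)].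
  apply/andP; split; apply/sleP=> i; have [iD|iD] := boolP (i \in D).
  - by rewrite ext_in.
  - by rewrite ext_out // wD.
  - by rewrite ext_in.
  - by rewrite ext_out // wD.
exists (tval (ext false), tval (ext true)); split=> /=.
- apply/sleP=> i; have [iD|iD] := boolP (i \in D); first by rewrite ext_in.
  by rewrite !ext_out.
- have [u <-] : exists u, psi u = ext true by apply/wP => i iD; rewrite ext_out.
  exact: fib_string_fib.
- by rewrite size_tuple.
- rewrite tile_dim_tnth -Dk; apply: eq_card => i; rewrite inE.
  have [iD|iD] := boolP (i \in D); first by rewrite !ext_in.
  by rewrite !ext_out // eqxx.
apply/setP=> x; rewrite inE; apply/idP/idP => [xC|/extP/wP[u ux]].
  apply/extP/wP; exists (g (exist _ x xC)).
  by rewrite /psi gK.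
by rewrite -(fib_val_inj ux); apply: valP.
Qed.

(** One tile is chosen per component; exact covering holds because the components partition the
    vertices. *)
Lemma cube_factor_tiling n (f : rel (fib_string n)) :
  cube_factor (@fib_cube_adj n) f ->
  exists2 l, tiling n l &
    size l = #|components f| /\ cube_poly f = tiling_poly l.
Proof.
case=> f_sym fe fQ.
have part : partition (components f) [set: fib_string n].
  apply: equivalence_partitionP => x y z _ _ _; split=> [|xy]; first exact: connect0.
  exact: same_connect (sym_connect_sym f_sym) _ _ xy z.
have [t tP] : exists t : {set fib_string n} -> tile, forall C,
    C \in components f -> [/\ sle (t C).1 (t C).2, fib (t C).2, size (t C).2 = n,
      is_Qcomp f (tile_dim (t C)) C & C = tile_set n (t C)].
  apply: (@fin_all_exists _ (fun=> tile) (fun C c => C \in components f ->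
    [/\ sle c.1 c.2, fib c.2, size c.2 = n, is_Qcomp f (tile_dim c) C &
        C = tile_set n c])) => C.
  have [CP|] := boolP (C \in components f); last by exists ([::], [::]).
  have [k kC] := fQ C CP.
  have [c [c1 c2 c3 c4 c5]] := is_Qcomp_tile_set fe kC.
  by exists c => _; split=> //; rewrite c4.
exists [seq t C | C <- enum (components f)]; first split=> [c /mapP[C + ->]|s sn fs].
- by rewrite mem_enum => CP; have [] := tP C CP.
- have [x xs] : exists x : fib_string n, s = x.
    have sn' : size s == n by apply/eqP.
    by exists (@FibString n (Tuple sn') fs).
  have [/eqP cov triv _] := and3P part.
  have xcov : x \in cover (components f) by rewrite cov inE.
  (* The only chosen tile containing [s] is that of the block of [x]. *)
  rewrite count_map (@eq_in_count _ _ (pred1 (pblock (components f) x))).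
    by rewrite count_uniq_mem ?enum_uniq // mem_enum pblock_mem.
  move=> C; rewrite mem_enum => CP /=; have [_ _ _ _ CE] := tP C CP.
  have -> : mem_tile (t C) s = (x \in C) by rewrite xs [in RHS]CE inE.
  apply/idP/eqP => [xC|->]; last by rewrite mem_pblock.
  exact/esym/def_pblock.
split; first by rewrite size_map -cardE.
apply/polyP=> k; rewrite coef_cube_poly /tiling_poly coef_sum big_map.
rewrite big_enum /= /num_Qcomp -sum1_card natr_sum.
rewrite big_mkcond [RHS]big_mkcond; apply: eq_bigr => C _; rewrite inE.
case: (boolP (C \in components f)) => //= CP; have [_ _ _ tQ _] := tP C CP.
(* The dimension of a component is unique, since it has [2 ^ k] vertices. *)
rewrite coefXn; case: (boolP (is_Qcomp f k C)) => [kQ|nkQ].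
  by rewrite (is_Qcomp_inj kQ tQ) eqxx.
by case: eqP nkQ => // ->; rewrite tQ.
Qed.

(** Comparison with the factor of the standard tiling bounds the number of components by that of
    maximal strings, so all tops are maximal. *)
Lemma optimal_cube_poly n (f : rel (fib_string n)) :
  optimal_cube_factor (@fib_cube_adj n) f -> cube_poly f = cube_poly_rec n.
Proof.
case=> fF f_min; have [l lT [size_l ->]] := cube_factor_tiling fF.
apply: (tiling_poly_max lT); apply: (tops_max_fib lT).
rewrite size_l -size_std_tiling.
apply: leq_trans (card_components_tile_rel (std_tilingP n)).
exact/f_min/tile_rel_factor/std_tilingP.
Qed.

(** * The generating function *)

Section PowerSeries.

Variable R : comUnitRingType.
Implicit Types a b d : fps R.
Local Open Scope ring_scope.

(** Here [d] is the [k]-th power of the variable, and multiplying by it shifts the coefficients. *)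
Lemma fps_mul_delta k d a n : (forall i, d i = (i == k)%:R) ->
  fps_mul d a n = if (k <= n)%N then a (n - k)%N else 0.
Proof.
move=> dE; rewrite /fps_mul; case: leqP => [le_kn|lt_nk].
  rewrite (bigD1 (inord k)) //= inordK ?ltnS // dE eqxx mul1r big1 ?addr0 // => i ik.
  rewrite dE; case: eqP => [e|]; last by rewrite mul0r.
  by case/eqP: ik; apply: val_inj; rewrite /= inordK ?ltnS.
rewrite big1 // => i _; rewrite dE; case: eqP => [e|]; last by rewrite mul0r.
by move: lt_nk; rewrite -e ltnNge -ltnS ltn_ord.
Qed.

Lemma fps_mul_trunc a b k n : (forall i, (k <= i)%N -> a i = 0) ->
  fps_mul a b n = \sum_(i < k | (i <= n)%N) a i * b (n - i)%N.
Proof.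
move=> a0; rewrite /fps_mul.
rewrite -(big_mkord xpredT (fun i => a i * b (n - i)%N)).
rewrite -(big_mkord (fun i => (i <= n)%N) (fun i => a i * b (n - i)%N)).
have [le_kn|lt_nk] := leqP k n.+1.
  rewrite (big_cat_nat _ (n := k)) //= [X in _ + X]big_nat_cond.
  rewrite [X in _ + X]big1 ?addr0 => [|i /andP[/andP[ki _] _]].
    2: by rewrite a0 ?mul0r.
  rewrite big_nat_cond [RHS]big_nat_cond; apply: eq_bigl => i; rewrite andbT.
  by case: (ltnP i k) => // ik; rewrite /= -ltnS (leq_trans ik).
rewrite [RHS](big_cat_nat _ (n := n.+1)) //= ?(ltnW lt_nk) //.
rewrite [X in _ = _ + X]big_nat_cond [X in _ = _ + X]big_pred0 ?addr0 => [|i].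
  rewrite big_nat_cond [RHS]big_nat_cond; apply: eq_bigl => i.
  by rewrite andbT ltnS; case: (i <= n)%N.
by rewrite (leqNgt i n); case: (n < i)%N; rewrite //= ?andbF.
Qed.

End PowerSeries.

Lemma cube_poly_rec_series : (cube_poly_rec : fps {poly int}) =1
  ((1%:S + 'Y * ('X%:S + 'Y)) / (1%:S - 'Y * 'Y * ('X%:S + 'Y)))%fps.
Proof.
move=> n; set N := (_ + _)%fps; set D := (_ - _)%fps.
have Y1 k : (fpsY : fps {poly int}) k = ((k == 1)%:R)%R by [].
have Y2 k : ((fpsY : fps {poly int}) * fpsY)%fps k = ((k == 2)%:R)%R.
  by rewrite (fps_mul_delta _ _ Y1); case: k => [|[|k]].
(* The numerator is [1 + x y + y^2], and the denominator below is [1 - x y^2 - y^3]. *)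
have ND : [/\ N 0%N = 1, N 1%N = 'X, N 2%N = 1 & forall k, (3 <= k)%N -> N k = 0]%R.
  rewrite /N /fps_add; split=> [||| [|[|[|k]]] // _];
  by rewrite (fps_mul_delta _ _ Y1) /= /fpsC /fpsY /= ?addr0 ?add0r.
have DD : [/\ D 0%N = 1, D 1%N = 0, D 2%N = - 'X & D 3%N = -1]%R /\
    forall k, 4 <= k -> D k = 0%R.
  rewrite /D /fps_sub /fps_add; split=> [|[|[|[|[|k]]]] // _]; first split;
  by rewrite (fps_mul_delta _ _ Y2) /= /fpsC /fpsY /= ?addr0 ?add0r ?subr0 ?oppr0.
have [[D0 D1 D2 D3] D4] := DD; have [N0 N1 N2 N3] := ND.
have := @fps_mulV _ D; rewrite D0 unitr1 => /(_ isT).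
rewrite /fps_div; move: (fps_inv D) => V DV.
have V0 : V 0 = 1%R.
  have := DV 0; rewrite (fps_mul_trunc _ _ D4) !big_mkcond !big_ord_recl big_ord0 /=.
  by rewrite D0 mul1r !addr0.
have V1 : V 1 = 0%R.
  have := DV 1; rewrite (fps_mul_trunc _ _ D4) !big_mkcond !big_ord_recl big_ord0 /=.
  by rewrite D0 D1 mul1r mul0r !addr0.
have V2 : V 2 = 'X%R.
  have := DV 2; rewrite (fps_mul_trunc _ _ D4) !big_mkcond !big_ord_recl big_ord0 /=.
  rewrite D0 D1 D2 V0 mul1r mul0r !addr0 add0r mulr1 => /eqP.
  by rewrite subr_eq0 => /eqP.
have VS k : V k.+3 = ('X * V k.+1 + V k)%R.
  have := DV k.+3; rewrite (fps_mul_trunc _ _ D4) !big_mkcond !big_ord_recl big_ord0 /=.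
  rewrite D0 D1 D2 D3 /bump /= !add1n !subSS !subn0 mul1r mul0r addr0 add0r.
  by rewrite mulNr mulN1r -opprD => /eqP; rewrite subr_eq0 => /eqP.
have W0 : (N * V)%fps 0 = 1%R.
  rewrite (fps_mul_trunc _ _ N3) !big_mkcond !big_ord_recl big_ord0 /=.
  by rewrite N0 V0 mul1r !addr0.
have W1 : (N * V)%fps 1 = 'X%R.
  rewrite (fps_mul_trunc _ _ N3) !big_mkcond !big_ord_recl big_ord0 /=.
  by rewrite N0 N1 V0 V1 mul1r mulr1 add0r !addr0.
have WS k : ((N * V)%fps k.+2 = V k.+2 + 'X * V k.+1 + V k)%R.
  rewrite (fps_mul_trunc _ _ N3) !big_mkcond !big_ord_recl big_ord0 /=.
  by rewrite N0 N1 N2 /bump /= !add1n !subSS !subn0 !mul1r addr0 addrA.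
elim/nat_ind3: n => [|||k IH IH1]; rewrite ?cube_poly_recE ?IH ?IH1 ?W0 ?W1 //.
  by rewrite WS V0 V1 V2 mulr0 addr0.
(* Two cases are split off because [WS] starts at index 2; the coefficients 0 and 1 come from [W0]
   and [W1]. *)
case: k {IH IH1} => [|[|k]]; rewrite !WS ?W0 ?W1 !VS ?V2 ?V1 ?V0; ring.
Qed.

Theorem theorem2p5
  (F : forall n : nat, rel (fib_string n))
  (F_optimal : forall n : nat, optimal_cube_factor (@fib_cube_adj n) (F n)) :
  ((fun n : nat => cube_poly (F n)) : fps {poly int})
  =1 ((1%:S + 'Y * ('X%:S + 'Y)) / (1%:S - 'Y * 'Y * ('X%:S + 'Y)))%fps.
Proof.
by move=> n; rewrite (optimal_cube_poly (F_optimal n)) cube_poly_rec_series.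
Qed.
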